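(* Let $(\mathcal{X},\Sigma,\{P_\theta\}_{\theta\in\Theta})$ be a statistical model and $\mu:\Sigma\to\overline{\mathbb{R}}$ a $\sigma$-finite measure such that $P_\theta\ll\mu$ for every $\theta\in\Theta$. Suppose that $(\mathcal{X},\Sigma)$ is an analytic Borel space, $(\mathcal{T},\Sigma_{\mathcal{T}})$ is a separable measurable space, and $T:\mathcal{X}\to\mathcal{T}$ is a measurable function. For each $\theta\in\Theta$, let $f_\theta:\mathcal{X}\to\mathbb{R}$ be a density of $P_\theta$ with respect to $\mu$. Suppose that there exists a non-empty countable subset $\Theta_0\subseteq\Theta$ such that, for each $\theta\in\Theta$, there exists a sequence $(\theta_n)_{n\in\mathbb{N}}$ of elements of $\Theta_0$ such that the limit $\lim_{n\to\infty}f_{\theta_n}$ exists in $\mathbb{R}$ $\mu$-a.e. and, for every $x\in\mathcal{X}$, $$f_\theta(x)=\begin{cases}\lim_{n\to\infty}f_{\theta_n}(x),&\text{if the limit exists (in }\mathbb{R}),\\0,&\text{otherwise.}\end{cases}$$ For $x\in\mathcal{X}$ define $D(x):=\big\{y\in\mathcal{X}:(\exists h_{xy}\in(0,\infty))(\forall\theta\in\Theta)\big(f_\theta(y)=f_\theta(x)h_{xy}\big)\big\}$. If for any $x,y\in\mathcal{X}$ we have $T(x)=T(y)$ if and only if $y\in D(x)$, then $T$ is minimal sufficient.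
   Context: A statistical model is a triple $(\mathcal{X},\Sigma,\{P_\theta\}_{\theta\in\Theta})$ with $(\mathcal{X},\Sigma)$ a measurable space, $\Theta$ a non-empty set and each $P_\theta$ a probability measure on $(\mathcal{X},\Sigma)$. A statistic is a measurable function $T:\mathcal{X}\to\mathcal{T}$ into a measurable space $(\mathcal{T},\Sigma_{\mathcal{T}})$. $T$ is sufficient iff for each $E\in\Sigma$ there is a measurable $\kappa_E:\mathcal{T}\to\mathbb{R}$ such that for every $\theta\in\Theta$, $P_\theta(E\mid T)=\kappa_E(T)$ $P_\theta$-a.e. (where $P_\theta(E\mid T)$ is the conditional probability given $\sigma(T)$). $T$ is minimal sufficient iff it is sufficient and, for every measurable space $(\mathcal{S},\Sigma_{\mathcal{S}})$ and every sufficient statistic $S:\mathcal{X}\to\mathcal{S}$, there is a measurable $f:\mathcal{S}\to\mathcal{T}$ such that for each $\theta\in\Theta$, $T=f(S)$ $P_\theta$-a.e. A density of $P_\theta$ with respect to $\mu$ is a Radon--Nikodym derivative $dP_\theta/d\mu$ (a particular version, defined at every point). A measurable space is countably generated iff its $\sigma$-algebra is generated by a countable collection of measurable sets; it is separable iff it is countably generated and every singleton is measurable. A standard Borel space is a measurable space whose $\sigma$-algebra is the Borel $\sigma$-algebra of a complete separable metric space. A measurable space $(\mathcal{X},\Sigma)$ is analytic Borel iff it is separable and there exist a standard Borel space $(\mathcal{Y},\Sigma_{\mathcal{Y}})$ and a surjective measurable function $\mathcal{Y}\to\mathcal{X}$. *)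

(* Defs.v *)
From HB Require Import structures.
From mathcomp Require Import all_boot all_order all_algebra.
From mathcomp Require Import all_classical all_reals all_analysis.

Set Implicit Arguments.
Unset Strict Implicit.
Unset Printing Implicit Defensive.

Import Order.TTheory GRing.Theory Num.Theory.
Import numFieldTopology.Exports.

Local Open Scope classical_set_scope.
Local Open Scope ring_scope.

(* [measurableType] and [{mfun _ >-> _}] carry nonempty spaces only.  This loses
   nothing here: the sample space carries a probability measure, and every
   other space is the codomain of a map from it or surjects onto it. *)

(** * Measurable spaces *)

Definition countably_generated (d : measure_display) (X : measurableType d) :
    Prop :=
  exists2 G : set (set X), countable G & @measurable d X = <<s G >>.

Definition separable_measurable (d : measure_display) (X : measurableType d) :
    Prop :=
  countably_generated X /\ forall x : X, measurable [set x].

Definition separable_space (M : topologicalType) : Prop :=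
  exists2 D : set M, countable D & dense D.

(* The library's [completePseudoMetricType] is a structure bundled with a base
   point; this is completeness as a property of a metric space. *)
Definition complete_metric (R : realType) (M : metricType R) : Prop :=
  forall u : nat -> M, cauchy (u @ \oo) -> exists l : M, u @ \oo --> l.

(* The metric space has the same carrier as [Y]: [c] ranges over the metric
   space structures on the type [Y]. *)
Definition standard_borel (R : realType) (d : measure_display)
    (Y : measurableType d) : Prop :=
  exists c : Metric.axioms_ R Y,
    let M : metricType R := Metric.Pack c in
    [/\ complete_metric M, separable_space M &
        @measurable d Y = <<s @open M >>].

Definition analytic_borel (R : realType) (d : measure_display)
    (X : measurableType d) : Prop :=
  separable_measurable X /\
  exists (d' : measure_display) (Y : measurableType d') (g : {mfun Y >-> X}),
    standard_borel R Y /\ range g = [set: X].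

(** * Statistical models *)

(* [f] is a real-valued, everywhere defined version of dP/dmu. *)
Definition is_density (R : realType) (d : measure_display)
    (X : measurableType d) (P mu : set X -> \bar R) (f : X -> R) : Prop :=
  measurable_fun [set: X] f /\
  forall A : set X, measurable A -> P A = (\int[mu]_(x in A) (f x)%:E)%E.

(* [g] is a version of the conditional probability P(E | sigma(T)); sigma(T) is
   [g_sigma_algebra_preimage T], and [g_sigma_algebra_preimageType T] is [X]
   equipped with it. *)
Definition is_cond_prob (R : realType) (d d' : measure_display)
    (X : measurableType d) (Y : measurableType d') (P : probability X R)
    (T : X -> Y) (E : set X) (g : X -> R) : Prop :=
  [/\ measurable_fun [set: g_sigma_algebra_preimageType T]
        (g : g_sigma_algebra_preimageType T -> R),
      P.-integrable [set: X] (EFin \o g) &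
      forall A : set X, g_sigma_algebra_preimage T A ->
        (\int[P]_(x in A) (g x)%:E)%E = P (E `&` A)].

Definition sufficient (R : realType) (d d' : measure_display)
    (X : measurableType d) (Y : measurableType d') (Theta : Type)
    (P : Theta -> probability X R) (T : {mfun X >-> Y}) : Prop :=
  forall E : set X, measurable E ->
  exists2 kappa : Y -> R, measurable_fun [set: Y] kappa &
    forall theta : Theta,
    exists2 g : X -> R, is_cond_prob (P theta) T E g &
      {ae P theta, forall x, g x = kappa (T x)}.

Definition minimal_sufficient (R : realType) (d d' : measure_display)
    (X : measurableType d) (Y : measurableType d') (Theta : Type)
    (P : Theta -> probability X R) (T : {mfun X >-> Y}) : Prop :=
  sufficient P T /\
  forall (d'' : measure_display) (Z : measurableType d'')
    (S : {mfun X >-> Z}),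
    sufficient P S ->
    exists2 phi : Z -> Y, measurable_fun [set: Z] phi &
      forall theta : Theta, {ae P theta, forall x, T x = phi (S x)}.

(* D(x) *)
Definition density_class (R : realType) (X Theta : Type)
    (f : Theta -> X -> R) (x : X) : set X :=
  [set y | exists2 h : R, 0 < h &
             forall theta : Theta, f theta y = f theta x * h].

(* Main.v *)
Require Import Defs.
From HB Require Import structures.
From mathcomp Require Import all_boot all_order all_algebra.
From mathcomp Require Import all_classical all_reals all_analysis.
From mathcomp Require Import measurable_realfun lra.

Set Implicit Arguments.
Unset Strict Implicit.
Unset Printing Implicit Defensive.

Import Order.TTheory GRing.Theory Num.Theory.
Import numFieldTopology.Exports.

Local Open Scope classical_set_scope.
Local Open Scope ring_scope.

(** Let (t n) enumerate the countable subfamily, let la be the mixture of the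
    P (t n) with positive weights w n, and let q be the density of la with
    respect to mu, the w-weighted sum of the positive parts of the f (t n).
    Every f theta is almost everywhere a limit of some of the f (t n), so la
    dominates the whole model, and the positive part of f theta divided by q is
    a density r theta of P theta with respect to la.  The numerator and q are
    both multiplied by h when x is replaced by a point of its density class with
    factor h, so r theta is constant on the classes, that is, on the fibres of
    T.  Conversely, on a set G of full la-measure, two points at which all the
    r (t n) agree lie in the same class: the factor is the ratio of the two
    values of q, and it passes to the limits f theta ([likelihood_ratios]).

    Both halves of the theorem then say that a function which is determined by
    some measurable data is a measurable function of these data.

    - Sufficiency: r theta is determined by T, hence r theta = k theta o T
      almost everywhere, and a model with such densities has T as a sufficient
      statistic ([sufficient_of_factorization], the Halmos-Savage and
      Fisher-Neyman criterion).
    - Minimality: if S is sufficient, then P theta has a density with respect to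
      la of the form g o S ([sufficient_density]), hence r (t n) = g n o S
      almost everywhere.  On G, the map T is determined by the r (t n), hence
      T = phi o S almost everywhere.

    The passage from determined to measurable is where the analytic sample space
    enters ([factorization_ae]).  It is a version modulo null sets of
    Blackwell's theorem, and rests on the universal measurability of analytic
    sets.  So does the extension of phi to the whole codomain of S: phi has to
    take its values in Y, and the set of arguments for which T provides a value
    is analytic and in general not measurable.  Universal measurability is
    proved in two steps.

    - An analytic Borel space X is the image of a closed subset D of the Baire
      space, and given countably many measurable subsets of X, the
      parametrization can be chosen so that their preimages are clopen in D
      ([analytic_parametrization]).
    - Given measurable sets B n in X and C n in Z, the set A of the z in Z for
      which some x in X satisfies B n x <-> C n z for all n contains a
      measurable set of full outer measure ([analytic_inner_approx]); this is
      the classical proof that the Suslin operation preserves measurability,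
      applied to measurable hulls of the pieces of A indexed by the finite
      prefixes of points of D. *)

(** * Analytic sets through the Baire space *)

(** The basic neighbourhoods of the Baire space.  Closedness and
    continuity are expressed through them, that is, by finite prefixes. *)
Definition agree (k : nat) (s t : nat -> nat) : Prop :=
  forall i, (i < k)%N -> s i = t i.

Lemma agreeW {k l s t} : (k <= l)%N -> agree l s t -> agree k s t.
Proof. by move=> kl st i ik; apply: st; exact: leq_trans ik kl. Qed.

Definition seq_closed (D : set (nat -> nat)) : Prop :=
  forall s, (forall k, exists2 t, D t & agree k t s) -> D s.

Definition rel_closed (C : (nat -> nat) -> (nat -> nat) -> Prop) : Prop :=
  forall s w,
    (forall k, exists s' w', [/\ C s' w', agree k s' s & agree k w' w]) ->
    C s w.

(** A single sequence [w] codes the countable family of the [component n w]. *)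
Definition component (n : nat) (w : nat -> nat) : nat -> nat :=
  fun i => w (pickle (n, i)).

Definition assemble (w : nat -> nat -> nat) : nat -> nat :=
  fun j => if unpickle j is Some (n, i) then w n i else 0%N.

Definition drop_first (w : nat -> nat) : nat -> nat := fun i => w i.+1.

Definition prepend (a : nat) (w : nat -> nat) : nat -> nat :=
  fun i => if i is j.+1 then w j else a.

Lemma component_assemble n w : component n (assemble w) = w n.
Proof. by apply/funext => i; rewrite /component /assemble pickleK. Qed.

Lemma component_agree n k : exists l, forall w w', agree l w w' ->
  agree k (component n w) (component n w').
Proof.
exists (\max_(i < k) (pickle (n, i : nat)).+1) => w w' ww' i ik.
apply: ww'; exact: (leq_bigmax (Ordinal ik)).
Qed.

Section analytic_subsets.
Context (M : Type) (F : set (nat -> nat)) (p : (nat -> nat) -> M).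

(** [B] is the projection of a closed set of pairs, read along a parametrization
    [p] of [M] by [F]: [w] is a certificate of membership in [B]. *)
Definition analytic_in (B : set M) : Prop :=
  exists2 C, rel_closed C & forall s, F s -> B (p s) <-> exists w, C s w.

(** The first entry of a certificate names a set of the family, the rest
    certifies membership in that set. *)
Lemma analytic_bigcup (B : nat -> set M) :
  (forall n, analytic_in (B n)) -> analytic_in (\bigcup_n B n).
Proof.
move=> /= aB.
have /choice[C HC] : forall n, exists C, rel_closed C /\
    forall s, F s -> B n (p s) <-> exists w, C s w.
  by move=> n; have [C] := aB n; exists C.
exists (fun s w => C (w 0%N) s (drop_first w)).
  move=> s w lim; apply: (HC _).1 => k.
  have [s' [w' [Cw ss' ww']]] := lim k.+1.
  exists s', (drop_first w'); split.
  - by rewrite -(ww' 0%N).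
  - exact: agreeW ss'.
  - by move=> i ik; apply: ww'.
move=> s Fs; split.
  move=> [n _ /((HC n).2 _ Fs)[w Cw]].
  by exists (prepend n w).
move=> [w Cw]; exists (w 0%N) => //.
by apply/((HC _).2 _ Fs); exists (drop_first w).
Qed.

(** A certificate is a family of certificates, one for each set. *)
Lemma analytic_bigcap (B : nat -> set M) :
  (forall n, analytic_in (B n)) -> analytic_in (\bigcap_n B n).
Proof.
move=> /= aB.
have /choice[C HC] : forall n, exists C, rel_closed C /\
    forall s, F s -> B n (p s) <-> exists w, C s w.
  by move=> n; have [C] := aB n; exists C.
exists (fun s w => forall n, C n s (component n w)).
  move=> s w lim n; apply: (HC _).1 => k.
  have [l rl] := component_agree n k.
  have [s' [w' [Cw ss' ww']]] := lim (maxn k l).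
  exists s', (component n w'); split => //.
  - exact: agreeW (leq_maxl _ _) ss'.
  - by apply: rl; exact: agreeW (leq_maxr _ _) ww'.
move=> s Fs; split.
  move=> Bs.
  have /choice[w Hw] : forall n, exists w, C n s w.
    by move=> n; apply/((HC _).2 _ Fs); exact: Bs.
  by exists (assemble w) => n; rewrite component_assemble.
by move=> [w Cw] n _; apply/((HC _).2 _ Fs); exists (component n w).
Qed.

Definition bianalytic (B : set M) : Prop := analytic_in B /\ analytic_in (~` B).

Hypothesis F_closed : seq_closed F.

(** Analytic sets are not stable under complement, but sets that are analytic
    together with their complement form a sigma-algebra, because countable
    unions and intersections preserve analyticity. *)
Lemma sigma_algebra_bianalytic : sigma_algebra [set: M] bianalytic.
Proof.
have a0 : analytic_in set0.
  exists (fun _ _ => False); first by move=> s w /(_ 0%N)[? [? []]].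
  by move=> s _; split => [//|[]].
have aT : analytic_in setT.
  by exists (fun _ _ => True) => // s _; split => // _; exists s.
split => [|A [aA aCA]|A aA]; rewrite /bianalytic.
- by rewrite setC0.
- by rewrite setTD setCK.
- rewrite setC_bigcup; split.
    by apply: analytic_bigcup => n; case: (aA n).
  by apply: analytic_bigcap => n; case: (aA n).
Qed.

(** Open sets: a certificate of membership in [U] is the length of a prefix that
    forces it; non-membership is itself a closed condition. *)
Lemma bianalytic_locally_decided (U : set M) :
  (forall s, F s -> U (p s) ->
     exists k, forall t, F t -> agree k t s -> U (p t)) ->
  bianalytic U.
Proof.
move=> oU; split.
  exists (fun s w => forall t, F t -> agree (w 0%N) t s -> U (p t)).
    move=> s w lim t Ft ts.
    have [s' [w' [Cw ss' ww']]] := lim (maxn 1 (w 0%N)).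
    apply: Cw => // i iw.
    have w0 : w' 0%N = w 0%N by apply: ww'; rewrite leq_max.
    rewrite w0 in iw.
    by rewrite ts// ss'// leq_max iw orbT.
  move=> s Fs; split.
    by move=> /(oU _ Fs)[k Uk]; exists (fun=> k).
  by move=> [w]; apply.
exists (fun s _ => F s /\ ~ U (p s)).
  move=> s w lim.
  have Fs : F s.
    by apply: F_closed => k; have [s' [w' [[Fs' _] ? ?]]] := lim k; exists s'.
  split => // /(oU _ Fs)[k Uk].
  have [s' [w' [[Fs' nUs'] ss' _]]] := lim k.
  exact/nUs'/Uk.
move=> s Fs; split => [nU|[w []]//].
by exists s.
Qed.

End analytic_subsets.

(** A point of [D] carries a parameter [q z] together with, for each [n], a bit
    that answers whether [p (q z)] is in [B n], and a certificate for the
    answer.  The answer is then read off from one entry of [z], so that [B n]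
    becomes clopen; wrong answers have no certificate, and [D] stays closed. *)
Lemma clopen_parametrization (M : Type) (F : set (nat -> nat))
    (p : (nat -> nat) -> M) (B : nat -> set M) :
  seq_closed F -> (forall n, bianalytic F p (B n)) ->
  exists D (q : (nat -> nat) -> nat -> nat), [/\ seq_closed D,
    forall z, D z -> F (q z),
    forall s, F s -> exists2 z, D z & q z = s &
    forall n, exists k, forall z z', D z -> D z' -> agree k z z' ->
      B n (p (q z)) <-> B n (p (q z'))].
Proof.
move=> Fc bB.
have /choice[C1 HC1] : forall n, exists C, rel_closed C /\
    forall s, F s -> B n (p s) <-> exists w, C s w.
  by move=> n; have [[C]] := bB n; exists C.
have /choice[C2 HC2] : forall n, exists C, rel_closed C /\
    forall s, F s -> ~ B n (p s) <-> exists w, C s w.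
  by move=> n; have [_ [C]] := bB n; exists C.
pose C n (b : bool) := if b then C1 n else C2 n.
have Ccl n b : rel_closed (C n b).
  by case: b; [exact: (HC1 n).1|exact: (HC2 n).1].
pose wit n z := component n.+1 z.
exists [set z | F (component 0 z) /\
  forall n, C n (wit n z 0%N == 0%N) (component 0 z) (drop_first (wit n z))],
  (component 0).
have dec n z : F (component 0 z) ->
    C n (wit n z 0%N == 0%N) (component 0 z) (drop_first (wit n z)) ->
    B n (p (component 0 z)) <-> wit n z 0%N = 0%N.
  move=> Fz; case: eqP => [e|ne] /= Cz; split => // Bz.
    by apply/((HC1 n).2 _ Fz); exists (drop_first (wit n z)).
  by exfalso; move: Bz; apply/((HC2 n).2 _ Fz); exists (drop_first (wit n z)).
split.
- move=> z lim; split.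
    apply: Fc => k; have [l rl] := component_agree 0 k.
    by have [t [Ft _] tz] := lim l; exists (component 0 t) => //; exact: rl.
  move=> n; apply: Ccl => k.
  have [l0 rl0] := component_agree 0 k.
  have [l rl] := component_agree n.+1 k.+1.
  have [t [Ft Ct] tz] := lim (maxn l0 l).
  have wt : agree k.+1 (wit n t) (wit n z).
    by apply: rl; exact: agreeW (leq_maxr _ _) tz.
  exists (component 0 t), (drop_first (wit n t)); split.
  + by rewrite -(wt 0%N).
  + by apply: rl0; exact: agreeW (leq_maxl _ _) tz.
  + by move=> i ik; exact: wt.
- by move=> z [].
- move=> s Fs.
  have /choice[w Hw] : forall n, exists w, C n (w 0%N == 0%N) s (drop_first w).
    move=> n; have [Bn|nBn] := pselect (B n (p s)).
      have [w Cw] := ((HC1 n).2 _ Fs).1 Bn.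
      by exists (prepend 0 w).
    have [w Cw] := ((HC2 n).2 _ Fs).1 nBn.
    by exists (prepend 1 w).
  pose z := assemble (fun n => if n is m.+1 then w m else s).
  have z0 : component 0 z = s by rewrite /z component_assemble.
  have zS n : wit n z = w n by rewrite /wit /z component_assemble.
  by exists z; rewrite //= z0; split => // n; rewrite zS.
- move=> n; have [k rk] := component_agree n.+1 1.
  exists k => z z' [Fz Cz] [Fz' Cz'].
  move=> /rk zz'; apply: (iff_trans (dec n z Fz (Cz n))).
  apply: iff_sym; apply: (iff_trans (dec n z' Fz' (Cz' n))).
  by rewrite /wit zz'.
Qed.

(** * Parametrization of analytic Borel spaces *)

(** The radii [2 ^- i], kept abstract so that linear arithmetic treats them as
    atoms. *)
Lemma dyadic_scale (R : realType) : exists eps : nat -> R,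
  [/\ forall i, 0 < eps i, forall i, eps i = 2 * eps i.+1 &
      forall r, 0 < r -> exists k, 4 * eps k < r].
Proof.
exists (fun i => 2^-1 ^+ i); split => [i|i|r r0].
- by rewrite exprn_gt0.
- by rewrite exprS mulrA divff ?mul1r.
- have [k _ Hk] : \forall k \near \oo, `|(2^-1 : R) ^+ k| < r / 4.
    have h1 : `|2^-1 : R| < 1 by rewrite ger0_norm//; lra.
    by have /cvgr0Pnorm_lt := cvg_expr h1; apply; lra.
  exists k; have := Hk k (leqnn k); rewrite ger0_norm ?exprn_ge0//; lra.
Qed.

(** Points of [F] are the indices of sequences in a dense countable set with
    consecutive distances at most [2 ^- i]; [p] takes the limit.  The condition
    is closed since it bears on finite prefixes, and a common prefix of length
    [k + 1] bounds the distance of the limits by [4 * 2 ^- k]. *)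
Lemma polish_parametrization (R : realType) (M : metricType R) (x0 : M) :
  complete_metric M -> separable_space M ->
  exists F (p : (nat -> nat) -> M), [/\ seq_closed F,
    forall x, exists2 s, F s & p s = x &
    forall U, open U -> forall s, F s -> U (p s) ->
      exists k, forall t, F t -> agree k t s -> U (p t)].
Proof.
move=> cM [D /countable_injP[c c_inj] dD].
have [h [h_gt0 hS small]] := dyadic_scale R.
pose e n := xget x0 [set x | D x /\ c x = n].
have eK x : D x -> e (c x) = x.
  move=> Dx; rewrite /e; case: xgetP => [y _ [Dy cy]|/(_ x)[]//].
  by apply: c_inj => //; rewrite inE.
pose F : set (nat -> nat) :=
  [set s | forall i, mdist (e (s i)) (e (s i.+1)) <= h i].
have tele s i k : F s ->
    mdist (e (s i)) (e (s (i + k)%N)) <= 2 * (h i - h (i + k)%N).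
  move=> Fs; elim: k => [|k IH]; first by rewrite addn0 mdistxx subrr mulr0.
  have := metric_triangle (e (s i)) (e (s (i + k)%N)) (e (s (i + k.+1)%N)).
  have := Fs (i + k)%N; rewrite addnS; have := hS (i + k)%N;  lra.
have teleW s i j : F s -> (i <= j)%N -> mdist (e (s i)) (e (s j)) <= 2 * h i.
  move=> Fs /subnKC <-; have := tele s i (j - i)%N Fs.
  by have := h_gt0 (i + (j - i))%N; lra.
have /choice[p Hp] : forall s, exists l : M, F s -> (e \o s) @ \oo --> l.
  move=> s; have [Fs|nFs] := pselect (F s); last by exists x0.
  have [l Hl] : exists l : M, (e \o s) @ \oo --> l.
    apply: cM; apply/cauchy_ballP => r r0.
    have [k kr] := small _ r0.
    exists ([set y | exists2 i, (k <= i)%N & y = e (s i)],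
            [set y | exists2 i, (k <= i)%N & y = e (s i)]) => /=.
      by split; exists k => // i /= ki; exists i.
    move=> [x y] /= [[i ki ->] [j kj ->]]; rewrite ballEmdist/=.
    have := metric_triangle (e (s i)) (e (s k)) (e (s j)).
    rewrite (metric_sym (e (s i)) (e (s k))).
    by have := teleW s k i Fs ki; have := teleW s k j Fs kj; lra.
  by exists l.
have pE s k : F s -> mdist (e (s k)) (p s) <= 2 * h k.
  move=> Fs; apply/ler_addgt0Pr => r r0.
  have /metricType_numDomainType.cvgrPdist_lt/(_ _ r0)[N _ HN] := Hp s Fs.
  have /= := HN (maxn N k) (leq_maxl _ _).
  have := metric_triangle (e (s k)) (e (s (maxn N k))) (p s).
  rewrite (metric_sym (p s)).
  by have := teleW s k _ Fs (leq_maxr N k); lra.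
exists F, p; split.
- move=> s lim i; have [t Ft ts] := lim i.+2.
  by rewrite -!ts.
- move=> x.
  have /choice[y Hy] : forall i, exists y, D y /\ mdist x y < h i.+2.
    move=> i; have [||y [/= xy Dy]] := dD (ball x (h i.+2))^°.
    + by exists x; apply: nbhsx_ballx.
    + exact: open_interior.
    + by exists y; split => //; move: (interior_subset xy); rewrite ballEmdist.
  pose s i := c (y i).
  have es i : e (s i) = y i by rewrite /s eK//; exact: (Hy i).1.
  have Fs : F s.
    move=> i; rewrite !es.
    have := metric_triangle (y i) x (y i.+1); rewrite (metric_sym (y i) x).
    have := (Hy i).2; have := (Hy i.+1).2.
    by have := hS i; have := hS i.+1; have := hS i.+2; have := h_gt0 i.+3; lra.
  exists s => //; apply: mdist_positivity.
  apply/eqP; rewrite eq_le mdist_ge0 andbT; apply/ler_addgt0Pr => r r0.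
  have [k kr] := small _ r0; rewrite add0r.
  have := metric_triangle (p s) (e (s k)) x.
  rewrite (metric_sym (p s) (e (s k))) (metric_sym (e (s k)) x) {2}es.
  have := pE s k Fs; have := (Hy k).2.
  by have := hS k; have := hS k.+1; have := h_gt0 k.+2; lra.
- move=> U oU s Fs Us.
  have : nbhs (p s) U by exact: open_nbhs_nbhs.
  move=> /nbhs_ballP[r r0 rU]; have [k kr] := small _ r0.
  exists k.+1 => t Ft ts; apply: rU; rewrite ballEmdist/=.
  have := metric_triangle (p s) (e (s k)) (p t).
  rewrite (metric_sym (p s) (e (s k))).
  by have := pE s k Fs; have := pE t k Ft; rewrite ts//; lra.
Qed.

(** The preimages of the [B n] in the standard Borel space are generated by open
    sets, hence bianalytic. *)
Lemma analytic_parametrization (R : realType) (d : measure_display)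
    (X : measurableType d) (B : nat -> set X) :
  analytic_borel R X -> (forall n, measurable (B n)) ->
  exists D (P : (nat -> nat) -> X), [/\ seq_closed D,
    forall x, exists2 z, D z & P z = x &
    forall n, exists k, forall z z', D z -> D z' -> agree k z z' ->
      B n (P z) <-> B n (P z')].
Proof.
move=> [_ [d' [Y [g [[c /= [cM sM YE]] g_surj]]]]] mB.
pose M : metricType R := Metric.Pack c.
have [F [p [Fc p_surj p_cont]]] := @polish_parametrization R M point cM sM.
have biB n : bianalytic F p (g @^-1` B n : set M).
  have : measurable (g @^-1` B n).
    by rewrite -[_ @^-1` _]setTI; exact: measurable_funP.
  rewrite YE; apply: smallest_sub; first exact: sigma_algebra_bianalytic.
  by move=> U oU; apply: bianalytic_locally_decided => //; exact: p_cont.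
have [D [q [Dc qF q_surj dec]]] := clopen_parametrization Fc biB.
exists D, (fun z => g (p (q z))); split => // x.
have [y _ gy] : range g x by rewrite g_surj.
have [s Fs ps] := p_surj y.
by have [z Dz qz] := q_surj s Fs; exists z => //; rewrite qz ps.
Qed.

(** * Universal measurability of analytic sets *)

(** The intersection of a sequence of measurable supersets of [A] whose measures
    approach the infimum. *)
Lemma measurable_hull (R : realType) (d : measure_display)
    (Z : measurableType d) (nu : {finite_measure set Z -> \bar R})
    (A : set Z) :
  exists H, [/\ measurable H, A `<=` H &
    forall B, measurable B -> A `<=` B -> nu (H `\` B) = 0%E].
Proof.
pose S := [set nu B | B in [set B | measurable B /\ A `<=` B]].
pose I := ereal_inf S.
have Ifin : I \is a fin_num.
  rewrite ge0_fin_numE; last by apply: le_ereal_inf_tmp => _ [B _ <-].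
  apply: (@le_lt_trans _ _ (nu setT)).
    by apply: ereal_inf_lbound; exists setT.
  by rewrite ltey_eq fin_num_measure.
have /choice[B HB] : forall n : nat, exists B, [/\ measurable B, A `<=` B &
    (nu B < I + (n.+1%:R^-1)%:E)%E].
  move=> n; have n0 : 0 < n.+1%:R^-1 :> R by rewrite invr_gt0.
  by have [_ [B [mB AB] <-] lt] := lb_ereal_inf_adherent n0 Ifin; exists B.
have mH : measurable (\bigcap_n B n).
  by apply: bigcapT_measurable => n; case: (HB n).
have nuH : (nu (\bigcap_n B n) <= I)%E.
  apply/lee_addgt0Pr => r r0.
  have [n nr] : exists n : nat, n.+1%:R^-1 < r.
    have [n _ /(_ n (leqnn n)) Hn] := near_infty_natSinv_lt (PosNum r0).
    by exists n.
  have [mBn _ /ltW le] := HB n.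
  apply: (le_trans (y := nu (B n))).
    by apply: le_measure; rewrite ?inE//; exact: bigcap_inf.
  by apply: (le_trans le); rewrite leeD2l// lee_fin ltW.
exists (\bigcap_n B n); split => // [x Ax n _|C mC AC].
  by have [_ AB _] := HB n; exact: AB.
have mHC : measurable (\bigcap_n B n `&` C) by exact: measurableI.
rewrite measureD//; last by rewrite ltey_eq fin_num_measure.
have IH : (I <= nu (\bigcap_n B n `&` C))%E.
  apply: ereal_inf_lbound; exists (\bigcap_n B n `&` C) => //; split => // x Ax.
  by split; [move=> n _; have [_ AB _] := HB n; exact: AB|exact: AC].
apply/eqP; rewrite eq_le sube_le0 (le_trans nuH IH)/=.
rewrite sube_ge0 ?fin_num_measure//.
by apply: le_measure; rewrite ?inE//.
Qed.

(** There are countably many Boolean patterns of length [k]. *)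
Lemma measurable_finite_pattern (d : measure_display) (Z : measurableType d)
    (C : nat -> set Z) (k : nat) (Phi : seq bool -> Prop) :
  (forall n, measurable (C n)) ->
  measurable [set z | Phi (mkseq (fun n => `[< C n z >]) k)].
Proof.
move=> mC; pose pat z := mkseq (fun n => `[< C n z >]) k.
have -> : [set z | Phi (pat z)] =
    \bigcup_(v in [set v : seq bool | Phi v]) [set z | pat z = v].
  apply/seteqP; split => [z Pz|z [v /= Pv zv]]; first by exists (pat z).
  by rewrite /= zv.
rewrite bigcup_mkcond; apply: countable_bigcupT_measurable => [|v].
  exact: countableP.
case: ifPn => // _.
have [sv|sv] := eqVneq (size v) k; last first.
  rewrite (_ : [set _ | _] = set0)// -subset0 => z /= zv.
  by apply: (negP sv); apply/eqP; rewrite -zv size_mkseq.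
have -> : [set z | pat z = v] =
    \bigcap_(n in [set n | (n < k)%N]) (if nth false v n then C n else ~` C n).
  apply/seteqP; split => [z <- n /= nk|z zv /=].
    by rewrite nth_mkseq//; case: asboolP.
  apply: (@eq_from_nth _ false); rewrite size_mkseq// => n nk.
  rewrite nth_mkseq//; have := zv n nk.
  by case: (nth false v n) => ?; [exact/asboolP|apply/asboolPn].
apply: bigcap_measurableType => n _.
by case: ifP => _; [exact: mC|exact: measurableC].
Qed.

Lemma mkseq_rcons (z : nat -> nat) k : mkseq z k.+1 = rcons (mkseq z k) (z k).
Proof. by rewrite /mkseq -addn1 iotaD map_cat cats1. Qed.

Lemma mkseq_agree k (s t : nat -> nat) : mkseq s k = mkseq t k -> agree k s t.
Proof.
by move=> st i ik; have := congr1 (nth 0%N ^~ i) st; rewrite !nth_mkseq.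
Qed.

(** [A] is the union of the pieces [As s] of the [z] matched by a point of [D]
    with prefix [s], and [As s] is the union of the [As (rcons s n)].  A
    measurable hull [H s] of [As s] is therefore covered up to a null set by the
    hulls [H (rcons s n)].  Outside the countably many exceptional null sets, a
    point [z] of [H [::]] lies in [H s] for all prefixes [s] of some sequence
    [t].  The hull is cut by the measurable set [Ks s], where the [C n] with [n]
    below the length of [s] are matched by a point of [D] with prefix [s];
    letting [s] run through the prefixes of [t] shows that [t] is in [D] and
    matches all of them, because each [B n] is clopen along [D]. *)
Lemma analytic_inner_approx (R : realType) (d d' : measure_display)
    (X : measurableType d) (Z : measurableType d')
    (nu : {finite_measure set Z -> \bar R})
    (B : nat -> set X) (C : nat -> set Z) :
  analytic_borel R X ->
  (forall n, measurable (B n)) -> (forall n, measurable (C n)) ->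
  let A := [set z | exists x, forall n, B n x <-> C n z] in
  exists W H, [/\ measurable W, measurable H, W `<=` A, A `<=` H &
    nu (H `\` W) = 0%E].
Proof.
move=> aX mB mC A.
have [D [P [Dc P_surj dec]]] := analytic_parametrization aX mB.
pose As (s : seq nat) : set Z := [set z | exists t, [/\ D t,
  mkseq t (size s) = s & forall n, B n (P t) <-> C n z]].
pose Ks (s : seq nat) : set Z := [set z | exists t, [/\ D t,
  mkseq t (size s) = s &
  forall n, (n < size s)%N -> B n (P t) <-> C n z]].
have mK s : measurable (Ks s).
  pose Phi (v : seq bool) := exists t, [/\ D t, mkseq t (size s) = s &
    forall n, (n < size s)%N -> B n (P t) <-> nth false v n].
  rewrite (_ : Ks s = [set z | Phi (mkseq (fun n => `[< C n z >]) (size s))]).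
    exact: measurable_finite_pattern.
  apply/seteqP; split => z [t [Dt ts tB]]; exists t; split => // n ns.
    rewrite nth_mkseq//; apply: (iff_trans (tB n ns)).
    by split => /asboolP.
  apply: (iff_trans (tB n ns)); rewrite nth_mkseq//.
  by split => /asboolP.
have /choice[H0 HH0] := fun s => measurable_hull nu (As s).
pose H s := H0 s `&` Ks s.
have mH s : measurable (H s) by apply: measurableI => //; case: (HH0 s).
have AH s : As s `<=` H s.
  move=> z Az; split; first by have [_ +_] := HH0 s; exact.
  by case: Az => t [Dt ts tB]; exists t.
have AsE s : As s `<=` \bigcup_n As (rcons s n).
  move=> z [t [Dt ts tB]]; exists (t (size s)) => //; exists t; split => //.
  by rewrite size_rcons mkseq_rcons ts.
pose N s := H s `\` \bigcup_n H (rcons s n).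
have mU s : measurable (\bigcup_n H (rcons s n)).
  by apply: bigcupT_measurable => n.
have mN s : measurable (N s) by exact: measurableD.
have N0 s : nu (N s) = 0%E.
  have [mH0 _ H0min] := HH0 s.
  apply/eqP; rewrite eq_le measure_ge0 andbT -(H0min _ (mU s)).
    apply: le_measure; rewrite ?inE//; first exact: measurableD.
    by move=> z [[]].
  by move=> z /AsE[n _ Az]; exists n => //; exact: AH.
(* The exceptional null sets [N s], indexed by the codes of the prefixes. *)
pose NN := \bigcup_n (oapp N set0 (unpickle n)).
have mNN : measurable NN.
  apply: bigcupT_measurable => n.
  by case: (unpickle n : option (seq nat)) => [s|] /=.
have NN0 : nu NN = 0%E.
  apply: (measure_negligible mNN); apply: negligible_bigcup => n.
  case: (unpickle n : option (seq nat)) => [s|]; last exact: negligible_set0.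
  by apply/negligibleP; [exact: mN|exact: N0].
exists (H [::] `\` NN), (H [::]); split => //.
- exact: measurableD.
- move=> z [Hz nNz].
  have step s : exists n, H s z -> H (rcons s n) z.
    have [Hs|nHs] := pselect (H s z); last by exists 0%N.
    apply: contrapT => nex; apply: nNz; exists (pickle s) => //.
    by rewrite pickleK /=; split => // -[n _ Hn]; apply: nex; exists n.
  have /choice[next Hnext] := step.
  (* The branch [t] is built together with its prefixes. *)
  pose pre := fix pre k := if k is k'.+1 then
    rcons (pre k') (next (pre k')) else [::].
  pose t k := next (pre k).
  have preE k : pre k = mkseq t k.
    by elim: k => [//|k IH]; rewrite mkseq_rcons -IH.
  have Hpre k : H (mkseq t k) z.
    by rewrite -preE; elim: k => [//|k IH]; exact: Hnext.
  have /choice[u Hu] : forall k, exists u, [/\ D u, agree k u t &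
      forall n, (n < k)%N -> B n (P u) <-> C n z].
    move=> k; have [_ [u [Du uk uB]]] := Hpre k.
    by exists u; rewrite size_mkseq in uk uB; split => //; exact: mkseq_agree.
  have Dt : D t by apply: Dc => k; have [] := Hu k; exists (u k).
  exists (P t) => n; have [k kn] := dec n.
  have [Du ut uB] := Hu (maxn k n.+1).
  apply: (iff_trans _ (uB n _)); last by rewrite leq_max ltnSn orbT.
  apply: iff_sym; apply: kn => //; exact: agreeW (leq_maxl _ _) ut.
- move=> z [x xB]; apply: AH; have [t Dt Pt] := P_surj x.
  by exists t; split => //; rewrite Pt.
- apply/eqP; rewrite eq_le measure_ge0 andbT -NN0.
  have mD : measurable (H [::] `\` NN) by exact: measurableD.
  apply: le_measure; rewrite ?inE//; first exact: measurableD.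
  by move=> z [Hz nz]; apply: contrapT => nN; apply: nz.
Qed.

(** * Measurable factorization modulo null sets *)

(** Stated as an equality of set functions, so that integrals can be rewritten
    along it. *)
Lemma finite_measure_of (R : realType) (d : measure_display)
    (Z : measurableType d) (m : {measure set Z -> \bar R}) :
  (m setT < +oo)%E ->
  exists nu : {finite_measure set Z -> \bar R}, nu = m :> (set Z -> \bar R).
Proof.
move=> moo; exists (mfrestr measurableT moo); apply/funext => A.
by rewrite /= /mfrestr /mrestr setIT.
Qed.

Lemma finite_pushforward (R : realType) (d d' : measure_display)
    (X : measurableType d) (Z : measurableType d')
    (la : {finite_measure set X -> \bar R}) (S : {mfun X >-> Z}) :
  exists nu : {finite_measure set Z -> \bar R},
    nu = pushforward la S :> (set Z -> \bar R).
Proof.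
have mS : measurable_fun setT S by exact: measurable_funP.
pose m : {measure set Z -> \bar R} :=
  measure_function_pushforward__canonical__measure_function_Measure la mS.
apply: (@finite_measure_of _ _ _ m).
by rewrite /= /pushforward preimage_setT ltey_eq fin_num_measure.
Qed.

Lemma mfun_preimage (d d' : measure_display) (X : measurableType d)
    (Z : measurableType d') (S : {mfun X >-> Z}) (B : set Z) :
  measurable B -> measurable (S @^-1` B).
Proof. by move=> mB; rewrite -[_ @^-1` _]setTI; exact: measurable_funP. Qed.

(** Two points that no generator separates are not separated by any measurable
    set, in particular not by the singletons. *)
Lemma separable_sequence (d : measure_display) (Y : measurableType d) :
  separable_measurable Y ->
  exists B : nat -> set Y, [/\ forall n, measurable (B n),
    @measurable d Y = <<s range B >> &
    forall y y', (forall n, B n y <-> B n y') -> y = y'].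
Proof.
move=> [[G /countable_injP[c c_inj] YG] m1].
pose B n := xget set0 [set A | G A /\ c A = n].
have BG n : B n = set0 \/ G (B n).
  by rewrite /B; case: xgetP => [A _ [GA _]|_]; [right|left].
have mB n : measurable (B n).
  have [->//|GB] := BG n; rewrite YG; exact: sub_sigma_algebra.
have YB : @measurable d Y = <<s range B >>.
  apply/seteqP; split; last first.
    apply: smallest_sub; first exact: sigma_algebra_measurable.
    by move=> _ [n _ <-].
  rewrite {1}YG; apply: smallest_sub; first exact: smallest_sigma_algebra.
  move=> A GA; apply: sub_sigma_algebra; exists (c A) => //.
  rewrite /B; case: xgetP => [A' _ [GA' cA]|/(_ A)[]//].
  by apply: c_inj => //; rewrite inE.
exists B; split => // y y' yy'.
suff : measurable `<=` [set A : set Y | A y <-> A y'].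
  by move=> /(_ _ (m1 y)) /= [+ _]; move=> /(_ erefl) ->.
rewrite YB; apply: smallest_sub; last by move=> _ [n _ <-]; exact: yy'.
split => [//|A [AB BA]|F HF] /=.
  by split => -[_ nA]; split => // ?; apply: nA; [exact: BA|exact: AB].
by split => -[n _ Fn]; exists n => //; apply/HF.
Qed.

Lemma separable_real (R : realType) : separable_measurable R.
Proof.
split; last by move=> x; exact: measurable_set1.
exists (range (fun q : rat => `]ratr q, +oo[%classic : set R)).
  exact: sub_countable (card_image_le _ _) (countableP _).
apply/seteqP; split; last first.
  apply: smallest_sub; first exact: sigma_algebra_measurable.
  by move=> _ [q _ <-]; exact: measurable_itv.
have RE : @measurable _ R = <<s @RGenOInfty.G R>> := RGenOInfty.measurableE R.
rewrite RE; apply: smallest_sub.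
  exact: smallest_sigma_algebra.
move=> _ [x ->].
have -> : `]x, +oo[%classic =
    \bigcup_q (if x <= ratr q then `]ratr q, +oo[%classic : set R else set0).
  apply/seteqP; split => [y|y [q _]] /=; rewrite ?in_itv/= ?andbT.
    move=> xy; have [q] := rat_in_itvoo xy.
    rewrite in_itv/= => /andP[xq qy].
    by exists q => //; rewrite (ltW xq)/= in_itv/= qy.
  by case: ifP => //= xq; rewrite in_itv/= andbT; exact: le_lt_trans.
apply: (@bigcupT_measurable_rat _ (g_sigma_algebraType
  (range (fun q : rat => `]ratr q, +oo[%classic : set R)))) => q.
case: ifP => _; last exact: measurable0.
by apply: sub_sigma_algebra; exists q.
Qed.

Section factorization.
Context (R : realType) (d d' : measure_display).
Context (X : measurableType d) (Z : measurableType d').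
Context (la : {finite_measure set X -> \bar R}) (S : {mfun X >-> Z}).
Context (Q : nat -> set X) (C : nat -> set Z) (G : set X).
Hypothesis X_analytic : analytic_borel R X.
Hypothesis mQ : forall n, measurable (Q n).
Hypothesis mC : forall n, measurable (C n).
Hypothesis mG : measurable G.
Hypothesis G_full : la (~` G) = 0%E.
Hypothesis QC : forall x, G x -> forall n, Q n x <-> C n (S x).

(** Blackwell's theorem modulo null sets: the points of [Z] that share their
    pattern [C] with a point of [E `&` G] form an analytic set, and its
    measurable inner approximation [W] cannot meet the image of [G `\` E],
    since [E] is saturated for the pattern. *)
Lemma saturated_preimage_ae (E : set X) : measurable E ->
  (forall x y, G x -> G y -> (forall n, Q n x <-> Q n y) -> E x -> E y) ->
  exists2 W : set Z, measurable W & {ae la, forall x, E x <-> W (S x)}.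
Proof.
move=> mE satE.
have [nu nuE] := finite_pushforward la S.
pose B n := if n is m.+1 then Q m else E `&` G.
pose D n := if n is m.+1 then C m else setT.
have mB n : measurable (B n) by case: n => [|n] //=; exact: measurableI.
have mD n : measurable (D n) by case: n => [|n] /=; [exact: measurableT|].
have [W [H [mW mH WA AH HW0]]] := analytic_inner_approx nu X_analytic mB mD.
exists W => //.
have aeG : {ae la, forall x, G x}.
  by exists (~` G); split => //; exact: measurableC.
have aeW : {ae la, forall x, ~ (H `\` W) (S x)}.
  exists (S @^-1` (H `\` W)); split.
  - by apply: mfun_preimage; exact: measurableD.
  - by rewrite -[la _]/(pushforward la S _) -nuE HW0.
  - by move=> x /= /contrapT.
apply: filterS2 aeG aeW => x Gx nHW; split => [Ex|/WA[y xy]].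
  apply: contrapT => nW; apply: nHW; split => //; apply: AH.
  by exists x => -[|n] /=; [by split|exact: QC].
have [_ /(_ Logic.I)[Ey Gy]] := xy 0%N.
apply: (satE y x) => // n; apply: (iff_trans (xy n.+1)).
by apply: iff_sym; exact: QC.
Qed.

(** Each [T @^-1` B n], for [B] a separating sequence in [Y], agrees almost
    everywhere with [S @^-1` D n].  A value [phi z] has to be a point [y] of [Y]
    with pattern [D n z]; it exists, as a value of [T], for [z] in an analytic
    set that contains almost every [S x].  On the measurable inner approximation
    [W] of this set [phi] is defined by it, and elsewhere by a constant. *)
Lemma factorization_ae (d'' : measure_display) (Y : measurableType d'')
    (T : X -> Y) :
  separable_measurable Y -> measurable_fun setT T ->
  (forall x y, G x -> G y -> (forall n, Q n x <-> Q n y) -> T x = T y) ->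
  exists2 phi : Z -> Y, measurable_fun setT phi &
    {ae la, forall x, T x = phi (S x)}.
Proof.
move=> /separable_sequence[B [mB YB B_sep]] mT T_sat.
have mTB n : measurable (T @^-1` B n) by rewrite -[_ @^-1` _]setTI; exact: mT.
have /choice[D HD] : forall n, exists W : set Z, measurable W /\
    {ae la, forall x, B n (T x) <-> W (S x)}.
  move=> n; have [||W mW WE] := @saturated_preimage_ae (T @^-1` B n).
  - exact: mTB.
  - by move=> x y Gx Gy xy /=; rewrite (T_sat x y).
  - by exists W.
have mD n : measurable (D n) by case: (HD n).
have [nu nuE] := finite_pushforward la S.
have [W [H [mW mH WA AH HW0]]] := analytic_inner_approx nu X_analytic mTB mD.
have /choice[phi Hphi] : forall z, exists y : Y,
    (W z -> forall n, B n y <-> D n z) /\ (~ W z -> y = point).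
  move=> z; have [Wz|nWz] := pselect (W z); last by exists point.
  by have [x Hx] := WA z Wz; exists (T x).
exists phi.
  apply: (measurability _ YB) => _ [_ [n _ <-] <-]; rewrite setTI.
  rewrite (_ : _ @^-1` _ = (W `&` D n) `|` (~` W `&` [set _ | B n point])).
    apply: measurableU; first exact: measurableI.
    apply: measurableI; first exact: measurableC.
    have [Bp|nBp] := pselect (B n point).
      by rewrite (_ : [set _ | _] = setT)//; apply/seteqP; split.
    by rewrite (_ : [set _ | _] = set0)//; apply/seteqP; split.
  apply/seteqP; split => z /=.
    have [Wz|nWz] := pselect (W z) => Bz.
      by left; split => //; apply/(Hphi z).1.
    by right; split => //; rewrite -((Hphi z).2 nWz).
  by move=> [[Wz /((Hphi z).1 Wz)]//|[nWz]]; rewrite ((Hphi z).2 nWz).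
have ae1 : {ae la, forall x, forall n, B n (T x) <-> D n (S x)}.
  by apply/ae_foralln => n; case: (HD n).
have ae2 : {ae la, forall x, ~ (H `\` W) (S x)}.
  exists (S @^-1` (H `\` W)); split.
  - by apply: mfun_preimage; exact: measurableD.
  - by rewrite -[la _]/(pushforward la S _) -nuE HW0.
  - by move=> x /= /contrapT.
apply: filterS2 ae1 ae2 => x BD nHW; apply: B_sep => n.
have Wx : W (S x).
  by apply: contrapT => nW; apply: nHW; split => //; apply: AH; exists x.
by apply: (iff_trans (BD n)); apply: iff_sym; exact: (Hphi (S x)).1.
Qed.

End factorization.

(** * Densities and mixtures *)

Section densities.
Context (R : realType) (d : measure_display) (X : measurableType d).
Local Open Scope ereal_scope.

Lemma density_dominates (mu : {measure set X -> \bar R})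
    (nu : {measure set X -> \bar R}) (g : X -> \bar R) :
  measurable_fun setT g ->
  (forall A, measurable A -> nu A = \int[mu]_(x in A) g x) -> nu `<< mu.
Proof.
move=> mg nug; apply/null_content_dominatesP => A mA A0.
by rewrite nug// null_set_integral//; exact: measurable_funTS.
Qed.

(** [g] agrees almost everywhere with the Radon-Nikodym derivative. *)
Lemma integral_density (mu : {sigma_finite_measure set X -> \bar R})
    (nu : {finite_measure set X -> \bar R}) (g h : X -> \bar R) (E : set X) :
  (forall x, 0 <= g x) -> measurable_fun setT g ->
  (forall A, measurable A -> nu A = \int[mu]_(x in A) g x) ->
  (forall x, 0 <= h x) -> measurable_fun setT h -> measurable E ->
  \int[nu]_(x in E) h x = \int[mu]_(x in E) (h x * g x).
Proof.
move=> g0 mg nug h0 mh mE.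
have numu : nu `<< mu by exact: density_dominates mg nug.
have mhE : measurable_fun E h by exact: measurable_funTS.
rewrite -(Radon_Nikodym_SigmaFinite.change_of_variables numu)//.
have fi := Radon_Nikodym_SigmaFinite.f_integrable numu.
have mf := measurable_int _ fi.
apply: ae_eq_integral => //.
- by apply: emeasurable_funM => //; exact: measurable_funTS.
- by apply: emeasurable_funM => //; exact: measurable_funTS.
apply: ae_eqe_mul2l; apply: (@ae_eq_subset _ _ _ _ mu setT) => //.
apply: integral_ae_eq => // A _ mA.
by rewrite -nug// -Radon_Nikodym_SigmaFinite.f_integral.
Qed.

Lemma ae_density (mu : {measure set X -> \bar R})
    (nu : {finite_measure set X -> \bar R}) (g h : X -> \bar R) :
  (forall x, 0 <= g x) ->
  measurable_fun setT g -> measurable_fun setT h ->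
  (forall A, measurable A -> nu A = \int[mu]_(x in A) g x) ->
  (forall A, measurable A -> nu A = \int[mu]_(x in A) h x) ->
  {ae mu, forall x, g x = h x}.
Proof.
move=> g0 mg mh nug nuh.
have : ae_eq mu setT g h.
  apply: integral_ae_eq => //.
    apply/integrableP; split => //.
    under eq_integral do rewrite gee0_abs//.
    by rewrite -nug// ltey_eq fin_num_measure.
  by move=> A _ mA; rewrite -nug// nuh.
by apply: filterS => x; exact.
Qed.

(** A density is nonnegative almost everywhere; its positive part is another
    version, because the set where it is negative has measure 0 under [nu]. *)
Lemma density_pos (mu nu : {measure set X -> \bar R}) (f : X -> R) :
  measurable_fun setT f ->
  (forall A, measurable A -> nu A = \int[mu]_(x in A) (f x)%:E) ->
  forall A, measurable A -> nu A = \int[mu]_(x in A) (Num.max (f x) 0%R)%:E.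
Proof.
move=> mf nuf A mA.
pose N := [set x | (f x < 0)%R].
have mN : measurable N by rewrite -[N]setTI; exact: measurable_fun_ltr.
have mAN : measurable (A `&` N) by exact: measurableI.
have mAD : measurable (A `\` N) by exact: measurableD.
have disj : [disjoint A `&` N & A `\` N].
  by apply/disj_set2P; rewrite setDE setIACA setICr setI0.
have mmax : measurable_fun setT (fun x => (Num.max (f x) 0%R)%:E).
  by apply/measurable_EFinP; apply: measurable_maxr => //.
have nuN : nu (A `&` N) = 0.
  apply/eqP; rewrite eq_le measure_ge0 andbT nuf// integralE.
  rewrite [X in X - _]integral0_eq ?sub0e; last first.
    by move=> x [_ /ltW fx]; rewrite funeposE; apply/max_idPr; rewrite lee_fin.
  by rewrite oppe_le0; apply: integral_ge0 => x _; exact: funeneg_ge0.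
have -> : nu A = nu (A `\` N).
  transitivity (nu (A `&` N) + nu (A `\` N)); last by rewrite nuN add0e.
  by rewrite -{1}(setUIDK A N); apply: measureU => //; exact/disj_set2P.
rewrite -[in RHS](setUIDK A N) ge0_integral_setU//; last 2 first.
- by rewrite setUIDK; exact: measurable_funTS.
- by move=> x _; rewrite lee_fin le_max lexx orbT.
rewrite [X in _ = X + _]integral0_eq ?add0e; last first.
  by move=> x [_ /ltW /max_idPr ->].
rewrite nuf//; apply: eq_integral => x; rewrite inE => -[_ /= /negP].
by rewrite -leNgt => /max_idPl ->.
Qed.

Lemma mixture_measure (m : nat -> probability X R) :
  exists (la : {finite_measure set X -> \bar R}) (w : nat -> R),
    [/\ forall n, (0 < w n)%R,
      forall A, measurable A -> la A = \sum_(n <oo) (w n)%:E * m n A &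
      forall h, (forall x, 0 <= h x) -> measurable_fun setT h ->
        forall A, measurable A ->
        \int[la]_(x in A) h x = \sum_(n <oo) (w n)%:E * \int[m n]_(x in A) h x].
Proof.
have w0 n : (0 <= (2 ^ n.+1)%:R^-1 :> R)%R by rewrite invr_ge0.
pose w n : {nonneg R} := NngNum (w0 n).
pose s n : {measure set X -> \bar R} := mscale (w n) (m n).
have sE A : mseries s 0 A = \sum_(n <oo) (w n)%:num%:E * m n A by [].
have [la laE] : exists nu : {finite_measure set X -> \bar R},
    nu = mseries s 0 :> (set X -> \bar R).
  apply: finite_measure_of; rewrite [X in X < _]sE.
  under eq_eseriesr do rewrite probability_setT mule1.
  apply: (le_lt_trans _ (ltry 1%R)).
  apply: le_trans (epsilon_trick0 xpredT ler01).
  by under [leRHS]eq_eseriesr do rewrite div1r.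
exists la, (fun n => (w n)%:num%R); split.
- by move=> n; rewrite /= invr_gt0 ltr0n expn_gt0.
- by move=> A _; rewrite laE.
- move=> h h0 mh A mA; rewrite laE ge0_integral_measure_series//; last first.
    exact: measurable_funTS.
  apply: eq_eseriesr => n _; rewrite ge0_integral_mscale//.
  exact: measurable_funTS.
Qed.

End densities.

(** * Likelihood ratios with respect to a dominating mixture *)

Lemma null_dominates_negligible (R : realType) (d : measure_display)
    (X : measurableType d) (mu nu : {measure set X -> \bar R}) (A : set X) :
  nu `<< mu -> mu.-negligible A -> nu.-negligible A.
Proof.
move=> /null_content_dominatesP numu [B [mB B0 AB]].
by exists B; split => //; exact: numu.
Qed.

Lemma measurable_inv (R : realType) : measurable_fun setT (@GRing.inv R).
Proof.
rewrite -(setvU [set 0%R]).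
apply/measurable_funU; [exact: measurableC|exact: measurable_set1|split].
  apply: open_continuous_measurable_fun.
    by apply: closed_openC; exact: closed_eq.
  by move=> x; rewrite inE => /eqP x0; exact: inv_continuous.
exact: measurable_fun_set1.
Qed.

Section mixture_density.
Context (R : realType) (d : measure_display) (X : measurableType d).
Context (Theta : Type) (P : Theta -> probability X R).
Context (mu : {sigma_finite_measure set X -> \bar R}) (f : Theta -> X -> R).
Context (t : nat -> Theta).
Hypothesis P_dom : forall theta, P theta `<< mu.
Hypothesis f_density : forall theta, is_density (P theta) mu (f theta).
Hypothesis f_lim : forall theta, exists n_ : nat -> nat, forall x,
  f theta x = if `[< cvg (f (t (n_ n)) x @[n --> \oo]) >]
              then lim (f (t (n_ n)) x @[n --> \oo]) else 0.

(** The limits, and the default value 0, inherit an upper bound 0. *)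
Lemma density_le0 x :
  (forall n, f (t n) x <= 0) -> forall theta, f theta x <= 0.
Proof.
move=> f0 theta; have [n_ ->] := f_lim theta.
case: asboolP => // cf; apply: limr_le => //; exact: nearW.
Qed.

(** Multiplication by [h > 0] preserves convergence and divergence, and the
    default value 0 is homogeneous. *)
Lemma density_scale x y h : 0 < h ->
  (forall n, f (t n) y = f (t n) x * h) ->
  forall theta, f theta y = f theta x * h.
Proof.
move=> h0 fh theta; have [n_ Hn] := f_lim theta; rewrite !Hn.
under eq_fun do rewrite fh.
case: asboolP => [cy|ncy]; case: asboolP => [cx|ncx].
- by rewrite limM//; [rewrite lim_cst|exact: is_cvg_cst].
- exfalso; apply: ncx.
  have -> : (fun n => f (t (n_ n)) x) = (fun n => f (t (n_ n)) x * h * h^-1).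
    by apply/funext => n; rewrite mulfK// gt_eqF.
  by apply: is_cvgM => //; exact: is_cvg_cst.
- exfalso; apply: ncy; apply: is_cvgM => //; exact: is_cvg_cst.
- by rewrite mul0r.
Qed.

Let fp theta x := Num.max (f theta x) 0.

Let fp0 theta x : 0 <= fp theta x.
Proof. by rewrite le_max lexx orbT. Qed.

Let mfp theta : measurable_fun setT (fun x => (fp theta x)%:E).
Proof.
apply/measurable_EFinP; apply: measurable_maxr => //.
by case: (f_density theta).
Qed.

Let Pfp theta A : measurable A ->
  P theta A = (\int[mu]_(x in A) (fp theta x)%:E)%E.
Proof. by case: (f_density theta) => mf Pf; exact: density_pos. Qed.

Let fp_eq : {ae mu, forall x, forall n, f (t n) x = fp (t n) x}.
Proof.
apply/ae_foralln => n; have [mf Pf] := f_density (t n).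
have : {ae mu, forall x, (fp (t n) x)%:E = (f (t n) x)%:E}.
  have mf' : measurable_fun setT (fun x => (f (t n) x)%:E).
    exact/measurable_EFinP.
  apply: (ae_density _ (mfp (t n)) mf' (@Pfp (t n)) Pf) => x.
  by rewrite lee_fin.
by apply: filterS => x [].
Qed.

(** Here [q] is the density of the mixture [la], with values in [[0, +oo]], and
    [r theta] is the positive part of [f theta] divided by [fine q]; both
    conventions [fine +oo = 0] and [x / 0 = 0] make it vanish where [q] is 0 or
    infinite.  These points are null for every [P theta]: [q] is [mu]-almost
    everywhere finite, and where it vanishes all [f (t n)] are nonpositive,
    hence so is [f theta].  [G] consists of the points where [0 < q < +oo] and
    where all the [f (t n)] equal their positive parts. *)
Lemma likelihood_ratios : exists (la : {finite_measure set X -> \bar R})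
    (w : nat -> R) (r : Theta -> X -> R) (G : set X),
  [/\ [/\ forall n, 0 < w n,
        forall A, measurable A -> la A = (\sum_(n <oo) (w n)%:E * P (t n) A)%E &
        forall h, (forall x, 0 <= h x)%E -> measurable_fun setT h ->
          forall A, measurable A -> (\int[la]_(x in A) h x =
            \sum_(n <oo) (w n)%:E * \int[P (t n)]_(x in A) h x)%E],
      [/\ forall theta x, 0 <= r theta x,
        forall theta, measurable_fun setT (r theta) &
        forall theta A, measurable A ->
          P theta A = (\int[la]_(x in A) (r theta x)%:E)%E],
      measurable G /\ la (~` G) = 0%E,
      forall x y, density_class f x y -> forall theta, r theta x = r theta y &
      forall x y, G x -> G y -> (forall n, r (t n) x = r (t n) y) ->
        density_class f x y].
Proof.
have [la [w [w0 laE la_int]]] := mixture_measure (fun n => P (t n)).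
pose q x := (\sum_(n <oo) (w n)%:E * (fp (t n) x)%:E)%E.
have wfp0 n x : (0 <= (w n)%:E * (fp (t n) x)%:E)%E.
  by rewrite mule_ge0// lee_fin// ltW.
have q0 x : (0 <= q x)%E by apply: nneseries_ge0.
have mwfp n : measurable_fun setT (fun x => ((w n)%:E * (fp (t n) x)%:E)%E).
  exact: emeasurable_funM.
have mq : measurable_fun setT q by exact: ge0_emeasurable_sum.
have la_q A : measurable A -> la A = (\int[mu]_(x in A) q x)%E.
  move=> mA; rewrite laE// integral_nneseries//; last first.
    by move=> n; exact: measurable_funTS.
  apply: eq_eseriesr => n _; rewrite ge0_integralZl//; last 3 first.
  - exact: measurable_funTS.
  - by move=> x _; rewrite lee_fin.
  - by rewrite lee_fin ltW.
  by rewrite Pfp.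
have q_fin : {ae mu, forall x, (q x < +oo)%E}.
  have : mu.-integrable setT q.
    apply/integrableP; split => //.
    under eq_integral do rewrite gee0_abs//.
    by rewrite -la_q// ltey_eq fin_num_measure.
  move=> /(integrable_ae measurableT); apply: filterS => x /(_ I).
  by rewrite ge0_fin_numE.
have q_pos x n : 0 < fp (t n) x -> (0 < q x)%E.
  move=> fx; apply: (@lt_le_trans _ _ ((w n)%:E * (fp (t n) x)%:E)%E).
    by rewrite mule_gt0// lte_fin.
  apply: le_trans (nneseries_lim_ge n.+1 _) => //.
  by rewrite big_nat_recr//= leeDr// sume_ge0.
pose r theta x := fp theta x / fine (q x).
pose G0 := [set x | 0 < q x]%E `&` [set x | q x < +oo]%E.
have mG0 : measurable G0.
  apply: measurableI.
    by rewrite -[X in measurable X]setTI; exact: emeasurable_fun_o_infty.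
  by rewrite -[X in measurable X]setTI; exact: emeasurable_fun_infty_o.
have negP0 theta A : measurable A -> (P theta).-negligible A -> P theta A = 0%E.
  exact: measure_negligible.
have PG0 theta : (P theta).-negligible (~` G0).
  rewrite setCI; apply: negligibleU.
    have mM : measurable (~` [set x | 0 < q x]%E).
      apply: measurableC.
      by rewrite -[X in measurable X]setTI; exact: emeasurable_fun_o_infty.
    apply/negligibleP => //.
    transitivity (\int[mu]_(x in ~` [set x | 0 < q x]%E) (fp theta x)%:E)%E.
      exact: Pfp.
    rewrite integral0_eq// => x /= /negP.
    rewrite -leNgt => qx; congr EFin; apply/max_idPr.
    apply: density_le0 => n; rewrite leNgt; apply/negP => fx.
    have : (0 < q x)%E by apply: (q_pos _ n); rewrite /fp lt_max fx.
    by rewrite ltNge qx.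
  exact: null_dominates_negligible (P_dom theta) q_fin.
pose G1 := \bigcap_n [set x | 0 <= f (t n) x].
have mG1 : measurable G1.
  apply: bigcapT_measurable => n; have [mf _] := f_density (t n).
  by rewrite -[X in measurable X]setTI; exact: measurable_fun_ler.
have G1E x n : G1 x -> f (t n) x = fp (t n) x.
  by move=> Gx; apply/esym/max_idPl; exact: Gx.
have PG1 theta : (P theta).-negligible (~` G1).
  apply: null_dominates_negligible (P_dom theta) _.
  apply: filterS fp_eq => x Gx n _ /=.
  by rewrite Gx; exact: fp0.
have mr theta : measurable_fun setT (r theta).
  apply: measurable_funM; first by apply/measurable_EFinP; exact: mfp.
  apply: (measurableT_comp (@measurable_inv R)).
  exact: (measurableT_comp (fine_measurable measurableT)).
exists la, w, r, (G0 `&` G1); split.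
- by split.
- split.
  + by move=> theta x; rewrite divr_ge0// fine_ge0.
  + exact: mr.
  + move=> theta A mA.
    have mrE : measurable_fun setT (fun x => (r theta x)%:E).
      exact/measurable_EFinP.
    rewrite (integral_density q0 mq la_q _ mrE)//; last first.
      by move=> x; rewrite lee_fin divr_ge0// fine_ge0.
    transitivity (P theta (A `&` G0)).
      rewrite (measureDI (P theta) mA mG0) [X in (X + _)%E]negP0 ?add0e//.
        exact: measurableD.
      by apply: negligibleS (PG0 theta) => x [].
    rewrite Pfp; last exact: measurableI.
    rewrite integral_mkcondr; apply: eq_integral => x _; rewrite patchE.
    case: ifPn => [|/negP]; rewrite inE /G0 /=.
      move=> [qx0 qxoo]; have qfin : q x \is a fin_num by rewrite ge0_fin_numE.
      rewrite -{1}(fineK qfin) -EFinM /r divfK// gt_eqF// fine_gt0//.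
      by rewrite qx0 qxoo.
    move=> nG; have [->|qx0] := eqVneq (q x) 0%E; first by rewrite mule0.
    have [qoo|qoo] := eqVneq (q x) +oo%E.
      by rewrite /r qoo /= invr0 mulr0 mul0e.
    by exfalso; apply: nG; rewrite lt_neqAle eq_sym qx0 q0 ltey.
- split; first exact: measurableI.
  rewrite laE; last by apply: measurableC; exact: measurableI.
  rewrite eseries0// => n _ _; rewrite negP0 ?mule0//.
    by apply: measurableC; exact: measurableI.
  by rewrite setCI; apply: negligibleU; [exact: PG0|exact: PG1].
- move=> x y [h h0 fh] theta.
  have fph theta' : fp theta' y = fp theta' x * h.
    by rewrite /fp fh maxr_pMl ?ltW// mul0r.
  have qh : q y = (h%:E * q x)%E.
    rewrite -nneseriesZl//; apply: eq_eseriesr => n _.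
    by rewrite fph [in RHS]muleCA -[in RHS]EFinM [in RHS](mulrC h).
  have -> : r theta y = fp theta x * h / (fine (q x) * h).
    rewrite /r fph qh; congr (_ / _).
    have [qfin|] := boolP (q x \is a fin_num); first by rewrite fineM// mulrC.
    rewrite ge0_fin_numE// -leNgt leye_eq => /eqP ->.
    by rewrite gt0_muley ?lte_fin//= mul0r.
  by rewrite /r invfM mulrACA mulfV ?gt_eqF// mulr1.
- move=> x y [[qx0 qxoo] G1x] [[qy0 qyoo] G1y] rxy.
  have qx : 0 < fine (q x) by rewrite fine_gt0// qx0 qxoo.
  have qy : 0 < fine (q y) by rewrite fine_gt0// qy0 qyoo.
  exists (fine (q y) / fine (q x)); first exact: divr_gt0.
  apply: density_scale; first exact: divr_gt0.
  move=> n; rewrite !G1E//; have := rxy n; rewrite /r => /eqP.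
  rewrite eqr_div ?(gt_eqF qx) ?(gt_eqF qy)// => /eqP fxy.
  by rewrite mulrA fxy mulfK// gt_eqF.
Qed.

End mixture_density.

(** * Densities and conditioning on a statistic *)

Section sufficiency.
Context (R : realType) (d d' : measure_display).
Context (X : measurableType d) (Z : measurableType d').
Context (la : {finite_measure set X -> \bar R}) (S : {mfun X >-> Z}).
Local Open Scope ereal_scope.

Let mS : measurable_fun setT S. Proof. exact: measurable_funP. Qed.

(** The law of [S] under [m] restricted to [E]. *)
Lemma finite_restriction_pushforward (m : {finite_measure set X -> \bar R})
    (E : set X) : measurable E ->
  exists nu : {finite_measure set Z -> \bar R},
    (forall B, nu B = m (E `&` S @^-1` B)) /\
    forall b B, (forall z, 0 <= b z) -> measurable_fun setT b -> measurable B ->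
      \int[nu]_(z in B) b z = \int[m]_(x in E `&` S @^-1` B) b (S x).
Proof.
move=> mE; have moo : m E < +oo by rewrite ltey_eq fin_num_measure.
pose mR : {finite_measure set X -> \bar R} := mfrestr mE moo.
have [nu nuE] := finite_pushforward mR S.
exists nu; split.
  by move=> B; rewrite nuE /pushforward /= /mfrestr /mrestr setIC.
move=> b B b0 mb mB.
have mbS : measurable_fun setT (b \o S) by exact: measurableT_comp mb mS.
have mSB : measurable (S @^-1` B) by exact: mfun_preimage.
rewrite nuE ge0_integral_pushforward//; last exact: measurable_funTS.
have mRE A : measurable A -> mR A = \int[m]_(x in A) (\1_E x)%:E.
  by move=> mA; rewrite integral_indic//= /mfrestr /mrestr setIC.
have m1E : measurable_fun setT (fun x => (\1_E x)%:E : \bar R).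
  by apply/measurable_EFinP; exact: measurable_indic.
have E0 x : 0 <= (\1_E x)%:E :> \bar R by rewrite lee_fin indicE.
rewrite (integral_density E0 m1E mRE _ mbS)//; last by move=> x; exact: b0.
rewrite setIC integral_mkcondr; apply: eq_integral => x _.
rewrite patchE indicE; case: ifPn => _; first by rewrite mule1.
by rewrite mule0.
Qed.

(** [a] is a version of the conditional probability of [E] given [S], so [a] is
    the density, with respect to the law of [S], of the law of [S] restricted to
    [E].  Both sides integrate [b] against the latter. *)
Lemma conditional_density (E : set X) (a b : Z -> \bar R) : measurable E ->
  (forall z, 0 <= a z) -> measurable_fun setT a ->
  (forall z, 0 <= b z) -> measurable_fun setT b ->
  (forall B, measurable B ->
    la (E `&` S @^-1` B) = \int[la]_(x in S @^-1` B) a (S x)) ->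
  forall B, measurable B -> \int[la]_(x in E `&` S @^-1` B) b (S x) =
    \int[la]_(x in S @^-1` B) (b (S x) * a (S x)).
Proof.
move=> mE a0 ma b0 mb laEa B mB.
have [nu nuE] := finite_pushforward la S.
have [nuE' [nuE'E nuE'_int]] := finite_restriction_pushforward la mE.
rewrite -nuE'_int//.
have nu_int c : (forall z, 0 <= c z) -> measurable_fun setT c ->
    forall A, measurable A ->
    \int[nu]_(z in A) c z = \int[la]_(x in S @^-1` A) c (S x).
  move=> c0 mc A mA; rewrite nuE ge0_integral_pushforward//.
  exact: measurable_funTS.
rewrite (@integral_density _ _ _ nu nuE' a)//.
  rewrite nu_int// => [z|]; first by rewrite mule_ge0.
  exact: emeasurable_funM.
by move=> A mA; rewrite nuE'E laEa// nu_int.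
Qed.

(** [g] is the density of the law of [S] under [P] with respect to its law under
    [la]. *)
Lemma pushforward_density (P : {finite_measure set X -> \bar R}) : P `<< la ->
  exists g : Z -> R, [/\ forall z, (0 <= g z)%R, measurable_fun setT g &
    forall b, (forall z, 0 <= b z) -> measurable_fun setT b ->
      \int[P]_x b (S x) = \int[la]_x (b (S x) * (g (S x))%:E)].
Proof.
move=> Pla.
have [nu nuE] := finite_pushforward la S.
have [rho rhoE] := finite_pushforward P S.
have rhonu : rho `<< nu.
  apply/null_content_dominatesP => B mB nuB.
  have laB : la (S @^-1` B) = 0 by rewrite -nuB /= nuE.
  rewrite rhoE; move/null_content_dominatesP : Pla; apply => //.
  exact: mfun_preimage.
pose g := Radon_Nikodym_SigmaFinite.f rho nu.
have g0 z : 0 <= g z by exact: Radon_Nikodym_SigmaFinite.f_ge0.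
have mg : measurable_fun setT g.
  by apply: measurable_int (Radon_Nikodym_SigmaFinite.f_integrable _).
have gfin z : g z \is a fin_num by exact: Radon_Nikodym_SigmaFinite.f_fin_num.
exists (fine \o g); split.
- by move=> z; exact: fine_ge0.
- exact: measurableT_comp (fine_measurable measurableT) mg.
move=> b b0 mb.
rewrite -[LHS]/(\int[P]_(x in S @^-1` setT) (b \o S) x).
rewrite -ge0_integral_pushforward// -rhoE.
rewrite (@integral_density _ _ _ nu rho g)//; last first.
  by move=> A mA; exact: Radon_Nikodym_SigmaFinite.f_integral.
have mbg : measurable_fun setT (fun z => b z * g z) by exact: emeasurable_funM.
transitivity (\int[pushforward la S]_z (b z * g z)); first by rewrite -nuE.
rewrite ge0_integral_pushforward//; last by move=> z _; rewrite mule_ge0.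
by apply: eq_integral => x _ /=; rewrite fineK.
Qed.

End sufficiency.

(** * Sufficiency and factorization of densities *)

Section factorization_criterion.
Context (R : realType) (d d' : measure_display).
Context (X : measurableType d) (Z : measurableType d').
Context (Theta : Type) (P : Theta -> probability X R).
Context (la : {finite_measure set X -> \bar R}) (S : {mfun X >-> Z}).
Local Open Scope ereal_scope.

Let mS : measurable_fun setT S. Proof. exact: measurable_funP. Qed.

(** The conditional probability [kappa] of [E] given [S] under [la] serves for
    every [P theta]: the factor [k theta o S] is a function of [S], and can be
    moved in and out of the conditioning. *)
Lemma sufficient_of_factorization (k : Theta -> Z -> R) :
  (forall theta z, (0 <= k theta z)%R) ->
  (forall theta, measurable_fun setT (k theta)) ->
  (forall theta A, measurable A ->
     P theta A = \int[la]_(x in A) (k theta (S x))%:E) ->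
  sufficient P S.
Proof.
move=> k0 mk Pk E mE.
pose laE : {finite_measure set X -> \bar R} := mrestr la mE.
have laEE A : laE A = la (E `&` A) by rewrite /laE /= /mrestr setIC.
have laEla : laE `<< la.
  apply/null_content_dominatesP => A mA A0; rewrite laEE.
  apply/eqP; rewrite eq_le measure_ge0 andbT -A0.
  by apply: le_measure; rewrite ?inE//; exact: measurableI.
have [kappa [kappa0 mkappa laE_kappa]] := pushforward_density S laEla.
have mkE theta : measurable_fun setT (fun z => (k theta z)%:E).
  exact/measurable_EFinP.
have mkappaE : measurable_fun setT (fun z => (kappa z)%:E).
  exact/measurable_EFinP.
have mkS theta : measurable_fun setT (fun x => (k theta (S x))%:E).
  exact: measurableT_comp (mkE theta) mS.
have mkappaS : measurable_fun setT (fun x => (kappa (S x))%:E).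
  exact: measurableT_comp mkappaE mS.
have laEk B : measurable B ->
    la (E `&` S @^-1` B) = \int[la]_(x in S @^-1` B) (kappa (S x))%:E.
  move=> mB; rewrite -laEE.
  have mSB : measurable (S @^-1` B) by exact: mfun_preimage.
  have -> : laE (S @^-1` B) = \int[laE]_x (\1_B (S x))%:E.
    by rewrite integral_indic// setIT.
  rewrite (laE_kappa (fun z => (\1_B z)%:E)); last 2 first.
  - by move=> z; rewrite lee_fin indicE.
  - by apply/measurable_EFinP; exact: measurable_indic.
  rewrite [RHS]integral_mkcond; apply: eq_integral => x _.
  rewrite patchE indicE (_ : (x \in S @^-1` B) = (S x \in B)); last first.
    by apply/idP/idP; rewrite !inE.
  by case: ifPn => [xB|xB]; rewrite ?mul1e ?mul0e.
exists kappa => // theta.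
have cond B : measurable B ->
    \int[P theta]_(x in S @^-1` B) (kappa (S x))%:E = P theta (E `&` S @^-1` B).
  move=> mB; have mSB : measurable (S @^-1` B) by exact: mfun_preimage.
  have kS0 x : 0 <= (k theta (S x))%:E by rewrite lee_fin.
  have kappaS0 x : 0 <= (kappa (S x))%:E by rewrite lee_fin.
  rewrite (integral_density kS0 (mkS theta) (Pk theta) kappaS0 mkappaS mSB).
  rewrite Pk; last exact: measurableI.
  have kE0 z : 0 <= (k theta z)%:E by rewrite lee_fin.
  have kappaE0 z : 0 <= (kappa z)%:E by rewrite lee_fin.
  rewrite (conditional_density mE kappaE0 mkappaE kE0 (mkE theta) laEk mB).
  by apply: eq_integral => x _; rewrite muleC.
exists (kappa \o S); last exact: aeW.
split.
- by move=> _ B mB; rewrite setTI; exists (kappa @^-1` B); rewrite ?setTI//;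
    rewrite -[_ @^-1` _]setTI; exact: mkappa.
- apply/integrableP; split=> //.
  under eq_integral do rewrite gee0_abs/= ?lee_fin//.
  rewrite -[X in integral _ X _](preimage_setT S) cond// preimage_setT setIT.
  by rewrite ltey_eq fin_num_measure.
- by move=> _ [B mB <-]; rewrite setTI; exact: cond.
Qed.

(** The common conditional probability [kappa] of [E] given [S] is also one
    under the mixture [la].  Hence [P theta E], which is the integral of [kappa]
    over the law of [S] under [P theta], is the [la]-integral of [kappa o S]
    times [g o S], and thus the integral of [g o S] over [E].  As [kappa] is
    nonnegative almost everywhere, its positive part is another version. *)
Lemma sufficient_density (t : nat -> Theta) (w : nat -> R) :
  sufficient P S ->
  (forall theta, P theta `<< la) ->
  (forall A, measurable A -> la A = \sum_(n <oo) (w n)%:E * P (t n) A) ->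
  (forall h, (forall x, 0 <= h x) -> measurable_fun setT h ->
     forall A, measurable A -> \int[la]_(x in A) h x =
       \sum_(n <oo) (w n)%:E * \int[P (t n)]_(x in A) h x) ->
  forall theta, exists g : Z -> R,
    [/\ forall z, (0 <= g z)%R, measurable_fun setT g &
      forall E, measurable E ->
        P theta E = \int[la]_(x in E) (g (S x))%:E].
Proof.
move=> sufS Pla laE la_int theta.
have [g [g0 mg g_int]] := pushforward_density S (Pla theta).
exists g; split => // E mE.
have [kappa mkappa Hkappa] := sufS E mE.
pose kp z := (Num.max (kappa z) 0%R)%:E.
have kp0 z : 0 <= kp z by rewrite lee_fin le_max lexx orbT.
have mkp : measurable_fun setT kp.
  by apply/measurable_EFinP; exact: measurable_maxr.
have mkpS : measurable_fun setT (fun x => kp (S x)).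
  exact: measurableT_comp mkp mS.
have cond theta' B : measurable B ->
    P theta' (E `&` S @^-1` B) = \int[P theta']_(x in S @^-1` B) kp (S x).
  move=> mB; have [gE [_ igE gE_int] gE_ae] := Hkappa theta'.
  pose Pt : {finite_measure set X -> \bar R} := P theta'.
  have [nu nuE] := finite_pushforward Pt S.
  have [nuE' [nuE'E _]] := finite_restriction_pushforward S Pt mE.
  have mSA A : measurable A -> measurable (S @^-1` A) by exact: mfun_preimage.
  have mkapS : measurable_fun setT (EFin \o (kappa \o S)).
    apply/measurable_EFinP; exact: measurableT_comp mkappa mS.
  have ikappa : (P theta').-integrable setT (EFin \o (kappa \o S)).
    have mgE := measurable_int _ igE.
    apply/integrableP; split=> //.
    have /integrableP[_] := igE; congr (_ < +oo).
    apply: ae_eq_integral => //; try exact: measurableT_comp.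
    by apply: filterS gE_ae => x /= -> .
  have nu_kappa A : measurable A -> nuE' A = \int[nu]_(z in A) (kappa z)%:E.
    move=> mA; transitivity (P theta' (E `&` S @^-1` A)).
      exact: nuE'E.
    rewrite -gE_int; last by exists A; rewrite ?setTI.
    have mgE := measurable_int _ igE.
    rewrite nuE integral_pushforward//.
    + apply: ae_eq_integral => //; first exact: mSA.
      * exact: measurable_funTS.
      * exact: measurable_funTS.
      * by apply: filterS gE_ae => x /= -> .
    + exact/measurable_EFinP.
    + by apply: (integrableS measurableT) => //; exact: mSA.
  transitivity (nuE' B); first by rewrite nuE'E.
  rewrite (density_pos mkappa nu_kappa)//.
  transitivity (\int[pushforward (P theta') S]_(z in B) kp z).
    by rewrite -nuE.
  rewrite ge0_integral_pushforward//; exact: measurable_funTS.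
have la_kappa B : measurable B ->
    la (E `&` S @^-1` B) = \int[la]_(x in S @^-1` B) kp (S x).
  move=> mB; have mSB : measurable (S @^-1` B) by exact: mfun_preimage.
  rewrite laE; last exact: measurableI.
  rewrite (la_int _ (fun x => kp0 (S x)) mkpS _ mSB).
  by apply: eq_eseriesr => n _; rewrite cond.
have gE0 z : 0 <= (g z)%:E by rewrite lee_fin.
have mgE : measurable_fun setT (fun z => (g z)%:E) by exact/measurable_EFinP.
rewrite -[in LHS](setIT E) -[in LHS](preimage_setT S) cond//.
rewrite preimage_setT g_int// -[in RHS](setIT E) -[in RHS](preimage_setT S).
rewrite (conditional_density mE kp0 mkp gE0 mgE la_kappa)// preimage_setT.
by apply: eq_integral => x _; rewrite muleC.
Qed.

End factorization_criterion.

(** * Minimal sufficiency *)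

Lemma countable_enumeration (T : Type) (A : set T) :
  A !=set0 -> countable A ->
  exists e : nat -> T,
    (forall n, A (e n)) /\ forall a, A a -> exists n, e n = a.
Proof.
move=> [a0 Aa0] /countable_injP[c c_inj].
have /choice[e He] : forall n, exists a,
    A a /\ forall b, A b -> c b = n -> b = a.
  move=> n; have [[a [Aa ca]]|nex] := pselect (exists a, A a /\ c a = n).
    exists a; split => // b Ab cb; apply: c_inj; rewrite ?inE//.
    by rewrite ca cb.
  by exists a0; split => // b Ab cb; exfalso; apply: nex; exists b.
exists e; split=> [n|a Aa]; first by case: (He n).
by exists (c a); apply/esym; apply: (He (c a)).2.
Qed.

Theorem mainTheorem4 (R : realType) (d d' : measure_display)
    (X : measurableType d) (Y : measurableType d')
    (Theta : Type) (Theta_nonempty : [set: Theta] !=set0)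
    (P : Theta -> probability X R)
    (mu : {sigma_finite_measure set X -> \bar R})
    (P_dom : forall theta : Theta, P theta `<< mu)
    (X_analytic : analytic_borel R X)
    (Y_separable : separable_measurable Y)
    (T : {mfun X >-> Y})
    (f : Theta -> X -> R)
    (f_density : forall theta : Theta, is_density (P theta) mu (f theta))
    (Theta0 : set Theta)
    (Theta0_nonempty : Theta0 !=set0)
    (Theta0_countable : countable Theta0)
    (f_lim : forall theta : Theta, exists t : nat -> Theta,
      [/\ forall n : nat, Theta0 (t n),
          {ae mu, forall x, cvg (f (t n) x @[n --> \oo])} &
          forall x : X,
            f theta x = if `[< cvg (f (t n) x @[n --> \oo]) >]
                        then lim (f (t n) x @[n --> \oo]) else 0])
    (T_class : forall x y : X, T x = T y <-> density_class f x y) :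
  minimal_sufficient P T.
Proof.
have [t [_ t_surj]] := countable_enumeration Theta0_nonempty Theta0_countable.
have f_lim_t theta : exists n_ : nat -> nat, forall x,
    f theta x = if `[< cvg (f (t (n_ n)) x @[n --> \oo]) >]
                then lim (f (t (n_ n)) x @[n --> \oo]) else 0.
  have [s [s0 _ fs]] := f_lim theta.
  have /choice[n_ Hn] : forall n, exists m, t m = s n.
    by move=> n; exact: t_surj.
  by exists n_ => x; under eq_fun do rewrite Hn.
have [la [w [r [G [[w0 laE la_int] [r0 mr Pr] [mG G0] r_class class_r]]]]] :=
  likelihood_ratios P_dom f_density f_lim_t.
have mrE theta : measurable_fun setT (fun x => (r theta x)%:E).
  exact/measurable_EFinP.
have Pla theta : P theta `<< la.
  exact: density_dominates (mrE theta) (Pr theta).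
have mT : measurable_fun setT T by exact: measurable_funP.
split.
  have [B [mB _ B_sep]] := separable_sequence Y_separable.
  have /choice[k Hk] : forall theta, exists k : Y -> R,
      measurable_fun setT k /\ {ae la, forall x, r theta x = k (T x)}.
    move=> theta.
    have [||||k mk kE] := @factorization_ae R _ _ X Y la T
      (fun n => T @^-1` B n) B setT X_analytic _ mB measurableT _ _
      _ R (r theta) (@separable_real R) (mr theta).
    - by move=> n; exact: mfun_preimage.
    - by rewrite setCT measure0.
    - by [].
    - move=> x y _ _ xy; apply: r_class; apply/T_class; exact: B_sep.
    - by exists k.
  apply: (@sufficient_of_factorization _ _ _ _ _ _ P la T
    (fun theta y => Num.max (k theta y) 0)).
  - by move=> theta y; rewrite le_max lexx orbT.
  - by move=> theta; apply: measurable_maxr => //; case: (Hk theta).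
  - move=> theta A mA; rewrite Pr//; apply: ae_eq_integral => //.
    + exact: measurable_funTS.
    + apply/measurable_EFinP; apply: measurable_funTS.
      apply: measurable_maxr => //.
      exact: measurableT_comp (Hk theta).1 mT.
    + apply: filterS (Hk theta).2 => x rk _.
      by rewrite -rk; congr EFin; apply/esym/max_idPl.
move=> d'' Z S sufS.
have mS : measurable_fun setT S by exact: measurable_funP.
have /choice[g Hg] : forall n, exists g : Z -> R,
    measurable_fun setT g /\ {ae la, forall x, r (t n) x = g (S x)}.
  move=> n.
  have [g [g0 mg Pg]] := sufficient_density sufS Pla laE la_int (t n).
  have mgS : measurable_fun setT (fun x => (g (S x))%:E).
    apply/measurable_EFinP.
    exact: measurableT_comp mg mS.
  exists g; split => //.
  have rE0 x : (0 <= (r (t n) x)%:E)%E by rewrite lee_fin.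
  have := ae_density rE0 (mrE (t n)) mgS (Pr (t n)) Pg.
  by apply: filterS => x [].
have [B [mB _ B_sep]] := separable_sequence (@separable_real R).
(* The data on which [T] depends: the sets [r (t n) @^-1` B j], indexed by codes
   of the pairs (n, j). *)
pose e (m : nat) : nat * nat := odflt (0, 0)%N (unpickle m).
have eK p : e (pickle p) = p by rewrite /e pickleK.
pose G' := G `&` \bigcap_n [set x | r (t n) x = g n (S x)].
have mG' : measurable G'.
  apply: measurableI => //; apply: bigcapT_measurable => n.
  rewrite -[X in measurable X]setTI.
  rewrite (_ : [set x | _] = [set x | r (t n) x == g n (S x)]); last first.
    by apply/seteqP; split => x /= /eqP.
  apply: measurable_fun_eqr => //.
  exact: measurableT_comp (Hg n).1 mS.
have G'0 : la (~` G') = 0%E.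
  apply: measure_negligible; first exact: measurableC.
  rewrite setCI; apply: negligibleU.
    by apply/negligibleP => //; exact: measurableC.
  have : {ae la, forall x, forall n, r (t n) x = g n (S x)}.
    by apply/ae_foralln => n; case: (Hg n).
  by apply: filterS => x rg n _ /=; exact: rg.
have [||||phi mphi Tphi] := @factorization_ae R _ _ X Z la S
    (fun m => r (t (e m).1) @^-1` B (e m).2)
    (fun m => g (e m).1 @^-1` B (e m).2) G' X_analytic _ _ mG' G'0 _
    _ Y T Y_separable mT.
- by move=> m; rewrite -[X in measurable X]setTI; exact: mr.
- by move=> m; rewrite -[X in measurable X]setTI; apply: (Hg _).1.
- by move=> x [_ rg] m /=; rewrite (rg _ Logic.I).
- move=> x y [Gx _] [Gy _] xy; apply/T_class; apply: class_r => // n.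
  by apply: B_sep => j; have := xy (pickle (n, j)); rewrite eK.
exists phi => // theta.
exact: null_dominates_negligible (Pla theta) Tphi.
Qed.
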